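(* Let $C=(v_0,v_1,\dots,v_n)$ be a directed circuit (traversed in the fixed order $v_0\to v_1\to\dots\to v_n\to v_0$) with distinguished origin $v_0$, let $k\ge 1$ VIPAs of capacity $\mathrm{Cap}$ operate in tram mode on $C$, and let $\sigma=(r_1,\dots,r_m)$ be a (fully known) request sequence, $r_j=(t_j,x_j,y_j,z_j)$, such that $v_0$ does not lie in the interior of the directed path from $x_j$ to $y_j$ along $C$ for any $j$. Then algorithm Opt-Tram (described in the context) outputs a feasible load-preemptive transportation schedule whose total tour length is minimum, i.e. it is an optimal offline solution with respect to minimizing the total tour length for VIPAs operating in tram mode on $C$.
   Context: Setting: a closed site is modelled by a network whose stations are nodes; distances are shortest-path lengths. A request is a 4-tuple $r_j=(t_j,x_j,y_j,z_j)$ with release date $t_j\ge 0$, origin station $x_j$, destination station $y_j$ and number of passengers $z_j$. VIPAs are vehicles of capacity $\mathrm{Cap}$ (at most $\mathrm{Cap}$ passengers on board at any time) moving at unit speed. A feasible transportation schedule consists of one tour per VIPA, each tour starting and ending at the depot/origin $v_0$, such that every passenger of every request $r_j$ is carried from $x_j$ to $y_j$ and no request is served before its release date $t_j$. The total tour length is the sum of the lengths of all tours. A schedule is load-preemptive if the $z_j$ passengers of one request may be carried by different VIPAs (each single passenger is carried from origin to destination by one VIPA). In tram mode, VIPAs may only move along the circuit $C$ in its fixed direction (and may wait or stop at stations), so each tour is a concatenation of full subtours $v_0\to v_1\to\cdots\to v_n\to v_0$, each of length $|C|$ (the length of the circuit). Algorithm Opt-Tram: (1) transform $C$ into the path $P=(v_0,v_1,\dots,v_n,v_0)$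 and, for each request $r_j$, create $z_j$ copies of the interval (subpath) $(x_j,y_j)$ of $P$, giving a multiset $\mathcal I$ of intervals; (2) sort the intervals by left endpoint; (3) build the interval graph $\mathcal G(\mathcal I)$ (nodes = intervals, adjacent iff the intervals share an edge of $P$) and colour it greedily in this order, giving each interval the smallest colour not used by an already coloured neighbour; (4) wait at $v_0$ until $t_m$, the largest release date; (5) while unserved passengers remain, choose $\mathrm{Cap}$ colour classes (or all remaining ones), assign the corresponding passengers to a VIPA and perform one full subtour of $C$ serving them. *)

(* Defs.v *)
From HB Require Import structures.
From mathcomp Require Import all_boot all_order all_algebra.

Set Implicit Arguments.
Unset Strict Implicit.
Unset Printing Implicit Defensive.

Import Order.TTheory GRing.Theory Num.Theory.
Local Open Scope ring_scope.

(* The stations of the circuit C = (v_0, ..., v_n) are the elements of 'I_n.+1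
   and v_0 is ord0. *)
Record request (R : Type) (n : nat) := Request {
  release : R;
  origin : 'I_n.+1;
  destination : 'I_n.+1;
  npassengers : nat
}.

(* Number of edges of the directed path from x to y along C. This path is
   non-empty: for x = y it is one complete round of C. *)
Definition hops (n : nat) (x y : 'I_n.+1) : nat :=
  if (x < y)%N then (y - x)%N else (y + n.+1 - x)%N.

(* [inZp i : 'I_n.+1] is the station of index i modulo n.+1. *)
Definition interior_of_path (n : nat) (x y v : 'I_n.+1) : Prop :=
  exists2 i : nat, (0 < i < hops x y)%N & inZp (x + i)%N = v.

(* The smallest natural number that does not occur in s; the search range
   starts at 0, so the position found is the number itself. *)
Definition mex (s : seq nat) : nat :=
  find [pred i | i \notin s] (iota 0 (size s).+1).

Fixpoint greedy_colouring_from (T : eqType) (adj : rel T)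
    (coloured : seq T) (c : T -> nat) (todo : seq T) : T -> nat :=
  if todo is p :: todo' then
    greedy_colouring_from adj (p :: coloured)
      [eta c with p |-> mex [seq c q | q <- coloured & adj p q]] todo'
  else c.

Definition greedy_colouring (T : eqType) (adj : rel T) (s : seq T) : T -> nat :=
  greedy_colouring_from adj [::] (fun=> 0%N) s.

Section Tram.

Variables (R : realFieldType) (n : nat).
(* len i is the length of the edge of C that leaves v_i. *)
Variable len : 'I_n.+1 -> R.
Variables (k Cap m : nat) (sigma : 'I_m -> request R n).

(* The i-th passenger of request r_j. *)
Definition passenger : finType := {j : 'I_m & 'I_(npassengers (sigma j))}.

Definition req (p : passenger) : request R n := sigma (tag p).

(* A tour in tram mode is given by the departure times of its successive moves:
   move s (counted from 0) leaves station [inZp s] at time d`_s and takes time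
   [len (inZp s)]. The VIPA waits at the station between arrival and next
   departure. The tour ends in v_0 iff n.+1 divides the number of moves. *)
Definition tram_tour (d : seq R) : Prop :=
  [/\ (n.+1 %| size d)%N,
      (forall s, (s < size d)%N -> 0 <= d`_s) &
      (forall s, (s.+1 < size d)%N -> d`_s + len (inZp s) <= d`_s.+1)].

Definition tour_length (d : seq R) : R := \sum_(s < size d) len (inZp s).

(* The passenger travels with [vipa], boarding just before its move number
   [board] and alighting just after its move number [alight] - 1. *)
Record ride := Ride { vipa : 'I_k; board : nat; alight : nat }.

(* [rides p = None] means that p is not served. *)
Record schedule := Schedule {
  tour : 'I_k -> seq R;
  rides : passenger -> option ride
}.

Definition carried (S : schedule) (p : passenger) (r : ride) : Prop :=
  [/\ (board r < alight r <= size (tour S (vipa r)))%N,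
      inZp (board r) = origin (req p),
      inZp (alight r) = destination (req p) &
      release (req p) <= (tour S (vipa r))`_(board r)].

Definition on_board (S : schedule) (v : 'I_k) (s : nat) (p : passenger) : bool :=
  if rides S p is Some r then (vipa r == v) && (board r <= s < alight r)%N
  else false.

(* Load-preemption: rides are assigned to passengers, not to requests. *)
Definition feasible (S : schedule) : Prop :=
  [/\ (forall v, tram_tour (tour S v)),
      (forall p, exists2 r, rides S p = Some r & carried S p r) &
      (forall v s, (s < size (tour S v))%N ->
         (#|[set p | on_board S v s p]| <= Cap)%N)].

Definition total_tour_length (S : schedule) : R :=
  \sum_(v < k) tour_length (tour S v).

Definition optimal (S : schedule) : Prop :=
  feasible S /\
  forall S', feasible S' -> total_tour_length S <= total_tour_length S'.

(* The path P = (v_0, ..., v_n, v_0) has nodes 0, ..., n.+1 and edges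
   0, ..., n, edge e joining e to e.+1. A destination v_0 is the last node of
   P. *)
Definition left_end (p : passenger) : nat := origin (req p).
Definition right_end (p : passenger) : nat :=
  if destination (req p) == ord0 then n.+1 else destination (req p).

Definition interval_adj (p q : passenger) : bool :=
  (p != q) && [exists e : 'I_n.+1,
    (left_end p <= e < right_end p)%N && (left_end q <= e < right_end q)%N].

Definition left_sorted (s : seq passenger) : Prop :=
  perm_eq s (enum passenger) /\
  sorted (fun p q => (left_end p <= left_end q)%N) s.

Definition last_release : R := \big[Num.max/0]_(j < m) release (sigma j).

(* A VIPA that has not moved yet waits in v_0 until the last release date;
   otherwise it is back in v_0 after its last move, along the edge
   leaving v_n. *)
Definition ready_time (d : seq R) : R :=
  if d is t :: d' then last t d' + len ord_max else last_release.

(* Departure times of a full subtour without waiting, started at time t. *)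
Definition subtour (t : R) : seq R :=
  mkseq (fun i => t + \sum_(j < n.+1 | (j < i)%N) len j) n.+1.

Definition initial : schedule := Schedule (fun=> [::]) (fun=> None).

Definition unserved (S : schedule) : seq passenger :=
  [seq p <- enum passenger | ~~ isSome (rides S p)].

Definition remaining (c : passenger -> nat) (S : schedule) : seq nat :=
  undup [seq c p | p <- unserved S].

(* VIPA v serves the colour classes in K in one more subtour. *)
Definition serve (c : passenger -> nat) (S : schedule) (v : 'I_k)
    (K : seq nat) : schedule :=
  let d := tour S v in
  Schedule [eta tour S with v |-> d ++ subtour (ready_time d)]
    (fun p => if c p \in K
              then Some (Ride v (size d + left_end p)%N (size d + right_end p)%N)
              else rides S p).

(* One iteration of the loop; the choices of v and K are arbitrary. *)
Definition round (c : passenger -> nat) (S S' : schedule) : Prop :=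
  unserved S != [::] /\
  exists v K, [/\ uniq K, {subset K <= remaining c S},
                  size K = minn Cap (size (remaining c S)) &
                  S' = serve c S v K].

Inductive loop (c : passenger -> nat) : schedule -> schedule -> Prop :=
| loop_exit S of unserved S = [::] : loop c S S
| loop_round S S' S'' of round c S S' & loop c S' S'' : loop c S S''.

(* S is the output of some execution; the order of the intervals with equal
   left endpoints is arbitrary. *)
Definition opt_tram_output (S : schedule) : Prop :=
  exists2 s, left_sorted s & loop (greedy_colouring interval_adj s) initial S.

(* No execution runs forever. *)
Definition opt_tram_terminates : Prop :=
  forall s, left_sorted s ->
    Acc (fun S' S => round (greedy_colouring interval_adj s) S S') initial.

End Tram.

(* Main.v *)
Require Import Defs.
From HB Require Import structures.
From mathcomp Require Import all_boot all_order all_algebra.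
From mathcomp Require Import zify.

Set Implicit Arguments.
Unset Strict Implicit.
Unset Printing Implicit Defensive.

Import Order.TTheory GRing.Theory Num.Theory.
Local Open Scope ring_scope.

(* Every tour consists of full subtours of length |C|, so the total tour length
   is |C| times the number of subtours.  In any feasible schedule all passengers
   whose interval contains a given edge e of P cross e, at most Cap of them per
   subtour; hence there are at least load(e) / Cap subtours.  Conversely, when
   the greedy colouring gives p a colour i, the i earlier neighbours of p with
   the smaller colours all contain the first edge of p, so the number of
   colours is the maximum load, and Opt-Tram uses one subtour per Cap
   colours. *)

(** * The least natural number missing from a list *)

(** Pigeonhole: the [(size s).+1] candidates are distinct and cannot all lie in [s], so the search
    succeeds within its range. *)
Lemma mex_notin (s : seq nat) : mex s \notin s.
Proof.
have h : has [pred i | i \notin s] (iota 0 (size s).+1).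
  apply/negbNE/negP => /hasPn h.
  have := uniq_leq_size (iota_uniq 0 (size s).+1).
  move/(_ s); rewrite size_iota ltnn => h'; suff: false by [].
  by apply: h' => i /h /=; rewrite negbK.
have := nth_find 0%N h; rewrite nth_iota ?add0n //.
by rewrite -[ltnRHS](size_iota 0) -has_find.
Qed.

Lemma lt_mex_in (s : seq nat) i : (i < mex s)%N -> i \in s.
Proof.
move=> lti; have := before_find 0%N lti; rewrite nth_iota ?add0n /=.
  by move/negbFE.
by apply: leq_trans lti _; rewrite -[leqRHS](size_iota 0) find_size.
Qed.

(** * Greedy colouring of a graph along a list *)

Section GreedyColouring.

Variables (T : eqType) (adj : rel T).

Lemma greedy_colouring_from_notin coloured c todo q :
  q \notin todo -> greedy_colouring_from adj coloured c todo q = c q.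
Proof.
elim: todo coloured c => //= p todo IH coloured c.
by rewrite inE negb_or => /andP[/negPf qp qtodo]; rewrite IH //= qp.
Qed.

(** A colour once given is never changed, so the [mex] taken on reaching [p] can be written with the
    final colouring [G]. The [catrev] form follows the accumulator: moving a vertex to [coloured]
    leaves the hypothesis convertible. *)
Lemma greedy_colouring_fromE coloured c todo1 p todo2 :
  uniq (catrev coloured (todo1 ++ p :: todo2)) ->
  let G := greedy_colouring_from adj coloured c (todo1 ++ p :: todo2) in
  G p = mex [seq G q | q <- catrev todo1 coloured & adj p q].
Proof.
elim: todo1 coloured c => [|q todo1 IH] coloured c /=; last first.
  by move=> u; apply: (IH (q :: coloured)).
rewrite catrevE cat_uniq => /and3P[_ disj /= /andP[pt _]].
rewrite greedy_colouring_from_notin //= eqxx; congr mex.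
apply/eq_in_map => q; rewrite mem_filter => /andP[_ qc].
have qn : q \notin p :: todo2.
  by apply: contra disj => qt; apply/hasP; exists q; rewrite ?mem_rev.
rewrite greedy_colouring_from_notin /=; last first.
  by move: qn; rewrite inE negb_or => /andP[].
by case: eqVneq qn => //= ->; rewrite mem_head.
Qed.

Lemma greedy_colouringE s1 p s2 : uniq (s1 ++ p :: s2) ->
  let c := greedy_colouring adj (s1 ++ p :: s2) in
  c p = mex [seq c q | q <- rev s1 & adj p q].
Proof. exact: (@greedy_colouring_fromE [::]). Qed.

(** Whichever of two neighbours comes later in [s] avoids the colour of the earlier one. *)
Lemma greedy_colouring_proper s p q : uniq s -> symmetric adj ->
  p \in s -> q \in s -> p != q -> adj p q ->
  greedy_colouring adj s p != greedy_colouring adj s q.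
Proof.
move=> us symadj.
wlog lt_qp : p q / (index q s < index p s)%N.
  move=> H ps qs npq apq; case: (ltngtP (index q s) (index p s)) => h.
  - exact: H.
  - by rewrite eq_sym; apply: H; rewrite // 1?eq_sym // symadj.
  - by move: (index_inj p qs ps h) npq => ->; rewrite eqxx.
move=> ps qs npq apq; move: us lt_qp; case/splitPr: ps => s1 s2 us.
have ps1 : p \notin s1.
  by move: us; rewrite cat_uniq => /and3P[_ /= /norP[]].
rewrite index_cat [index p _]index_cat (negPf ps1) /= eqxx addn0.
case: ifP => [qs1 _|_]; last by rewrite ltnNge leq_addr.
rewrite greedy_colouringE //; set l := map _ _.
apply: contraNneq (mex_notin l) => ->.
by apply: map_f; rewrite mem_filter mem_rev apq.
Qed.

End GreedyColouring.

(** * Rounds of the circuit and a union bound *)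

Lemma sum_inZp_mul (V : zmodType) n (F : 'I_n.+1 -> V) q :
  \sum_(s < q * n.+1) F (inZp s) = (\sum_i F i) *+ q.
Proof.
elim: q => [|q IH]; first by rewrite big_ord0.
rewrite mulSn big_split_ord /= mulrS; congr (_ + _).
  by apply: eq_bigr => i _; congr F; apply: val_inj; rewrite /= modn_small.
rewrite -IH; apply: eq_bigr => i _; congr F.
by apply: val_inj; rewrite /= modnDl.
Qed.

Lemma leq_card_bigcup (I T : finType) (A : I -> {set T}) (b : I -> nat) :
  (forall i, #|A i| <= b i)%N -> (#|\bigcup_i A i| <= \sum_i b i)%N.
Proof.
move=> leAb; elim/big_ind2: _ => [|X x Y y leX leY|i _] //.
  by rewrite cards0.
by apply: leq_trans (leq_add leX leY); rewrite -cardsUI leq_addr.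
Qed.

(** Such a path wraps around: it meets $v_0$ after [n.+1 - x] edges and goes on to [y]. *)
Lemma ord0_interior_of_path n (x y : 'I_n.+1) :
  y != ord0 -> (y <= x)%N -> interior_of_path x y ord0.
Proof.
rewrite -val_eqE /= => y0 le_yx; have lt_x := ltn_ord x.
exists (n.+1 - x)%N; last by apply: val_inj; rewrite /= subnKC ?modnn // ltnW.
by rewrite /hops [(x < y)%N]ltnNge le_yx /=; lia.
Qed.

(** * Intervals of the path $P$ and the load of its edges *)

Section Intervals.

Variables (R : realFieldType) (n m : nat) (sigma : 'I_m -> request R n).
Hypothesis v0_not_interior : forall j,
  ~ interior_of_path (origin (sigma j)) (destination (sigma j)) ord0.
Implicit Types p q : passenger sigma.

Lemma left_end_lt p : (left_end p < n.+1)%N.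
Proof. exact: ltn_ord. Qed.

Lemma right_end_le p : (right_end p <= n.+1)%N.
Proof. by rewrite /right_end; case: ifP => // _; apply: ltnW. Qed.

(** The hypothesis on $v_0$ enters here, by excluding wrapped paths; a destination $v_0$ is the last
    node of $P$. *)
Lemma left_end_lt_right_end p : (left_end p < right_end p)%N.
Proof.
rewrite /right_end; case: eqVneq => [_|y0]; first exact: left_end_lt.
rewrite /left_end ltnNge; apply/negP => le_yx.
by apply: (@v0_not_interior (tag p)); apply: ord0_interior_of_path.
Qed.

Lemma inZp_left_end p t : inZp (t * n.+1 + left_end p) = origin (req p).
Proof. by apply: val_inj; rewrite /= modnMDl modn_small ?left_end_lt. Qed.

Lemma inZp_right_end p t : inZp (t * n.+1 + right_end p) = destination (req p).
Proof.
apply: val_inj; rewrite /= modnMDl /right_end.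
by case: eqP => [->|_]; rewrite ?modnn // modn_small.
Qed.

Lemma eq_left_end p a : inZp a = origin (req p) ->
  a = (a %/ n.+1 * n.+1 + left_end p)%N.
Proof. by rewrite /left_end => <- /=; rewrite -divn_eq. Qed.

(** For destination $v_0$ the offset within a round is [n.+1] rather than 0, so the quotient drops
    by one; [0 < a] makes this possible. *)
Lemma eq_right_end p a : (0 < a)%N -> inZp a = destination (req p) ->
  exists b, a = (b * n.+1 + right_end p)%N.
Proof.
rewrite /right_end => a_gt0 <-; case: eqVneq => [/(congr1 val) /= a0|_].
  exists (a %/ n.+1).-1%N; rewrite {1}(divn_eq a n.+1) a0 addn0 -mulSnr prednK //.
  by rewrite divn_gt0 // dvdn_leq // /dvdn a0.
by exists (a %/ n.+1)%N; rewrite /= -divn_eq.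
Qed.

Lemma interval_adjP p q : reflect
  (p != q /\ exists e, (left_end p <= e < right_end p)%N &&
                       (left_end q <= e < right_end q)%N)
  (interval_adj p q).
Proof.
apply: (iffP andP) => [[npq /existsP[e He]]|[npq [e He]]]; split=> //.
  by exists (e : nat).
have en : (e < n.+1)%N by have := right_end_le p; lia.
by apply/existsP; exists (Ordinal en).
Qed.

Lemma interval_adj_sym : symmetric (@interval_adj R n m sigma).
Proof.
move=> p q; rewrite /interval_adj eq_sym; congr (_ && _).
by apply: eq_existsb => e; rewrite andbC.
Qed.

Lemma left_sorted_uniq (s : seq (passenger sigma)) : left_sorted s -> uniq s.
Proof. by case=> /perm_uniq -> _; apply: enum_uniq. Qed.

Lemma left_sorted_mem (s : seq (passenger sigma)) p : left_sorted s -> p \in s.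
Proof. by case=> /perm_mem -> _; rewrite mem_enum. Qed.

Definition load (e : nat) : nat :=
  #|[set p : passenger sigma | (left_end p <= e < right_end p)%N]|.

(* An earlier neighbour of p starts no later than p and meets it, so it
   contains the first edge of p. *)
Lemma greedy_colour_lt_load s p : left_sorted s ->
  (greedy_colouring (@interval_adj R n m sigma) s p < load (left_end p))%N.
Proof.
move=> ls; have us := left_sorted_uniq ls; have ps := left_sorted_mem p ls.
case: ls => _; move: us; case/splitPr: ps => s1 s2.
set c := greedy_colouring _ _ => us srt.
(* All of 0, ..., [c p] occur as colours over the first edge of [p]: [c p] at [p] itself, each
   smaller one at an earlier neighbour. *)
rewrite -(size_iota 0 (c p).+1).
rewrite /load cardE -(size_map c); apply: uniq_leq_size; first exact: iota_uniq.
move=> i; rewrite mem_iota leq0n add0n ltnS leq_eqVlt /= => /orP[/eqP ->|].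
  by apply: map_f; rewrite mem_enum inE leqnn left_end_lt_right_end.
rewrite {1}/c greedy_colouringE // -/c => /lt_mex_in /mapP[q].
rewrite mem_filter mem_rev => /andP[/interval_adjP[_ [e He]] qs1] ->.
apply: map_f; rewrite mem_enum inE.
have le_qp : (left_end q <= left_end p)%N.
  move: srt; rewrite sorted_pairwise; last by move=> a b d; apply: leq_trans.
  rewrite pairwise_cat => /and3P[/allrelP h _ _].
  by apply: h => //; rewrite mem_head.
by move: He le_qp; lia.
Qed.

End Intervals.

(** * Lower bound on the number of subtours *)

Section LowerBound.

Variables (R : realFieldType) (n : nat) (len : 'I_n.+1 -> R).
Variables (k Cap m : nat) (sigma : 'I_m -> request R n).

Definition nsubtours (S : schedule k sigma) : nat :=
  \sum_(v < k) size (tour S v) %/ n.+1.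

Lemma tour_lengthE (d : seq R) : (n.+1 %| size d)%N ->
  tour_length len d = (\sum_i len i) *+ (size d %/ n.+1).
Proof. by move=> /divnK dvd; rewrite /tour_length -sum_inZp_mul dvd. Qed.

Lemma total_tour_lengthE (S : schedule k sigma) :
  (forall v, tram_tour len (tour S v)) ->
  total_tour_length len S = (\sum_i len i) *+ nsubtours S.
Proof.
move=> tt; rewrite /total_tour_length /nsubtours -sumrMnr.
by apply: eq_bigr => v _; apply: tour_lengthE; case: (tt v).
Qed.

(* The rider may stay on board for additional full rounds. *)
Lemma carried_crosses (S : schedule k sigma) p r e :
  (n.+1 %| size (tour S (vipa r)))%N -> carried S p r ->
  (left_end p <= e < right_end p)%N ->
  exists2 t, (t < size (tour S (vipa r)) %/ n.+1)%N &
             (board r <= t * n.+1 + e < alight r)%N.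
Proof.
move=> dvd [/andP[lt_ba le_a] /eq_left_end def_b dest_a _] /andP[le_e lt_e].
have [|b' def_a] := eq_right_end _ dest_a; first by apply: leq_trans lt_ba.
set a := (board r %/ n.+1)%N in def_b.
have le_r := right_end_le p.
(* A smaller [b'] would place alighting no later than the start of round [a], hence not after
   boarding. *)
have le_ab : (a <= b')%N.
  rewrite leqNgt; apply/negP => lt_b'a.
  have := leq_mul lt_b'a (leqnn n.+1); rewrite mulSn; lia.
have le_mul := leq_mul le_ab (leqnn n.+1).
(* The round of boarding already passes over [e]. *)
exists a; last by lia.
rewrite -(ltn_pmul2r (ltn0Sn n)) divnK //; lia.
Qed.

(** Each passenger counted in the load lies in some [A v t], the set of those on board [v] over edge
    [e] in its subtour [t]; capacity bounds every such set by [Cap]. *)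
Lemma load_le (S : schedule k sigma) e : feasible len Cap S ->
  (load sigma e <= nsubtours S * Cap)%N.
Proof.
case: (ltnP e n.+1) => [lt_e|le_e _]; last first.
  rewrite /load eq_card0 // => p; rewrite !inE.
  by apply/negP; have := right_end_le p; lia.
case=> tt served cap.
have -> : (nsubtours S * Cap =
    \sum_(v < k) \sum_(t < size (tour S v) %/ n.+1) Cap)%N.
  rewrite /nsubtours big_distrl /=; apply: eq_bigr => v _.
  by rewrite sum_nat_const card_ord.
pose A v (t : nat) := [set p | on_board S v (t * n.+1 + e) p].
apply: leq_trans (_ : #|\bigcup_(v < k)
    \bigcup_(t < size (tour S v) %/ n.+1) A v t| <= _)%N.
  apply/subset_leq_card/subsetP => p; rewrite inE => pe.
  have [r rp cr] := served p; have [dvd _ _] := tt (vipa r).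
  have [t lt_t bta] := carried_crosses dvd cr pe.
  apply/bigcupP; exists (vipa r) => //; apply/bigcupP.
  by exists (Ordinal lt_t) => //; rewrite inE /on_board rp eqxx.
apply: leq_card_bigcup => v; apply: leq_card_bigcup => t.
apply: cap; have [dvd _ _] := tt v; rewrite -[ltnRHS](divnK dvd).
by have := leq_mul (ltn_ord t) (leqnn n.+1); rewrite mulSn; lia.
Qed.

End LowerBound.

(** * Departure times when a full subtour is appended *)

Section Subtour.

Variables (R : realFieldType) (n : nat) (len : 'I_n.+1 -> R).
Variables (m : nat) (sigma : 'I_m -> request R n).
Hypothesis len_gt0 : forall i, 0 < len i.

Lemma nth_subtour t i : (i < n.+1)%N ->
  (subtour len t)`_i = t + \sum_(j < n.+1 | (j < i)%N) len j.
Proof. by move=> lt_i; rewrite nth_mkseq. Qed.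

Lemma nth_subtour_ge t i : (i < n.+1)%N -> t <= (subtour len t)`_i.
Proof.
by move=> lt_i; rewrite nth_subtour // lerDl sumr_ge0 // => j _; apply: ltW.
Qed.

Lemma nth_subtourS t i : (i.+1 < n.+1)%N ->
  (subtour len t)`_i.+1 = (subtour len t)`_i + len (inZp i).
Proof.
move=> lt_i; have lt_i' := ltnW lt_i.
rewrite !nth_subtour // -addrA; congr (_ + _).
have val_i : (inZp i : 'I_n.+1) = i :> nat by rewrite /= modn_small.
rewrite (bigD1 (inZp i)) ?val_i //= addrC; congr (_ + _).
by apply: eq_bigl => j; rewrite -val_eqE /= modn_small; lia.
Qed.

Lemma ready_timeE d : (0 < size d)%N ->
  ready_time len sigma d = d`_(size d).-1 + len ord_max.
Proof. by case: d => //= t d _; rewrite (last_nth 0). Qed.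

Lemma ready_time_ge d :
  (forall s, (s < size d)%N -> last_release sigma <= d`_s) ->
  last_release sigma <= ready_time len sigma d.
Proof.
case: (posnP (size d)) => [/size0nil -> //|d_gt0 late].
have := late (size d).-1; rewrite ltn_predL ready_timeE // => /(_ d_gt0) le_d.
by apply: le_trans le_d _; rewrite lerDl ltW.
Qed.

Lemma last_release_ge0 : 0 <= last_release sigma.
Proof.
rewrite /last_release; elim/big_rec: _ => // j x _ x0.
by rewrite le_max x0 orbT.
Qed.

Lemma release_le_last_release j : release (sigma j) <= last_release sigma.
Proof. by rewrite /last_release (bigD1 j) //= le_max lexx. Qed.

(** Keeping all departures after the last release date settles every release constraint at once, and
    also gives nonnegative times. *)
Lemma late_cat_subtour d :
  (forall s, (s < size d)%N -> last_release sigma <= d`_s) ->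
  let d' := d ++ subtour len (ready_time len sigma d) in
  forall s, (s < size d')%N -> last_release sigma <= d'`_s.
Proof.
move=> late d' s; rewrite size_cat size_mkseq nth_cat => lt_s.
case: ltnP => [|le_ds]; first exact: late.
by apply: le_trans (ready_time_ge late) (nth_subtour_ge _ _); lia.
Qed.

Lemma tram_tour_cat_subtour d :
  (forall s, (s < size d)%N -> last_release sigma <= d`_s) ->
  tram_tour len d -> tram_tour len (d ++ subtour len (ready_time len sigma d)).
Proof.
move=> late [dvd _ step]; split.
- by rewrite size_cat size_mkseq dvdn_addl ?dvdnn.
- by move=> s /(late_cat_subtour late); apply: le_trans last_release_ge0.
move=> s; rewrite size_cat size_mkseq !nth_cat => lt_s.
have [lt_ds|lt_sd|eq_s] := ltngtP s.+1 (size d).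
- exact: step.
- rewrite ltnS in lt_sd; rewrite subSn // nth_subtourS; last first.
    by rewrite -subSn // ltn_subLR // leqW.
  rewrite le_eqVlt; apply/orP; left; apply/eqP; congr (_ + len _); apply: val_inj => /=.
  by rewrite -[in LHS](subnKC lt_sd) -modnDml (eqP dvd).
(* At the seam the new subtour starts exactly at [ready_time]. The last move of [d] leaves $v_n$
   because [n.+1] divides [size d]. *)
rewrite eq_s subnn nth_subtour // big_pred0 // addr0.
rewrite ready_timeE -?eq_s //=.
suff -> : inZp s = ord_max :> 'I_n.+1 by [].
apply: val_inj => /=; rewrite -eq_s in dvd.
move: dvd => /dvdnP[[|q]] //; rewrite mulSn => -[->].
by rewrite addnC modnMDl modn_small.
Qed.

End Subtour.

(** * Executions of the loop: invariant, feasibility, number of rounds *)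

Section OptTram.

Variables (R : realFieldType) (n : nat) (len : 'I_n.+1 -> R).
Variables (k Cap m : nat) (sigma : 'I_m -> request R n).
Hypothesis len_gt0 : forall i, 0 < len i.
Hypothesis v0_not_interior : forall j,
  ~ interior_of_path (origin (sigma j)) (destination (sigma j)) ord0.
Variable c : passenger sigma -> nat.
Implicit Types S : schedule k sigma.

(** Each ride stays within a single subtour, whose index is recovered as [board r %/ n.+1]; the
    rides of one subtour use at most [Cap] colours. *)
Record tram_invariant S : Prop := TramInvariant {
  inv_tour : forall v, tram_tour len (tour S v);
  inv_late : forall v s, (s < size (tour S v))%N ->
    last_release sigma <= (tour S v)`_s;
  inv_ride : forall p r, rides S p = Some r -> exists t,
    [/\ board r = (t * n.+1 + left_end p)%N,
        alight r = (t * n.+1 + right_end p)%N &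
        (t.+1 * n.+1 <= size (tour S (vipa r)))%N];
  inv_colours : forall v t, exists2 K : seq nat, (size K <= Cap)%N &
    forall p r, rides S p = Some r -> vipa r = v -> (board r %/ n.+1)%N = t ->
    c p \in K
}.

Lemma initial_invariant : tram_invariant (initial k sigma).
Proof. by split=> //= v t; exists [::]. Qed.

(** The new subtour of [v] gets as index the old number of its subtours, so the colours used there
    are those in [K]. *)
Lemma serve_invariant S v K : (size K <= Cap)%N ->
  tram_invariant S -> tram_invariant (serve len c S v K).
Proof.
move=> szK [tt late ride cols].
have [dvd _ _] := tt v.
split=> /=.
- move=> w; case: eqP => // _; apply: tram_tour_cat_subtour => //; exact: late.
- move=> w; case: eqP => [_|_]; last exact: late.
  by apply: late_cat_subtour => //; apply: late.
- move=> p r; case: ifP => [_ [<-]|_ /ride[t [-> -> le_t]]].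
    exists (size (tour S v) %/ n.+1)%N; rewrite /= divnK // eqxx; split=> //.
    by rewrite size_cat size_mkseq mulSn divnK // addnC.
  exists t; split=> //; case: eqP => // <-.
  by rewrite size_cat; apply: leq_trans le_t (leq_addr _ _).
move=> w t.
have [/andP[/eqP -> /eqP ->]|neq_vt] :=
  boolP ((w == v) && (t == size (tour S v) %/ n.+1)%N).
  (* An older ride of [v] ends within the old tour and cannot have the new index. *)
  exists K => // p r; case: ifP => // _ /ride[t' [-> _ le_t]] eqv.
  rewrite divnMDl // divn_small ?left_end_lt // addn0 => eqt.
  by move: le_t; rewrite eqv eqt mulSn divnK // addSn ltnNge leq_addl.
have [K' szK' HK'] := cols w t; exists K' => // p r.
case: ifP => [_ [<-] /= vw eqt|_]; last exact: HK'.
case/negP: neq_vt; rewrite -vw eqxx /= -eqt.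
by rewrite divnDl // (divn_small (left_end_lt p)) addn0.
Qed.

Lemma unservedP S p : (p \in unserved S) = ~~ isSome (rides S p).
Proof. by rewrite mem_filter mem_enum andbT. Qed.

Lemma loop_unserved S S' : loop len Cap c S S' -> unserved S' = [::].
Proof. by elim. Qed.

Lemma loop_invariant S S' :
  loop len Cap c S S' -> tram_invariant S -> tram_invariant S'.
Proof.
elim=> // {}S S1 S2 [_ [v [K [_ _ szK ->]]]] _ IH inv; apply: IH.
by apply: serve_invariant => //; rewrite szK geq_minl.
Qed.

(** Passengers on board together share a subtour and an edge of $P$, so their colours differ; the
    subtour has at most [Cap] colours. *)
Lemma invariant_feasible S :
  (forall p q, p != q -> interval_adj p q -> c p != c q) ->
  tram_invariant S -> unserved S = [::] -> feasible len Cap S.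
Proof.
move=> proper [tt late ride cols] all_served; split=> // [p|v s lt_s].
  case rp: (rides S p) => [r|]; last first.
    by have := unservedP S p; rewrite all_served rp.
  exists r => //; have [t [eb ea le_t]] := ride _ _ rp.
  have lt_lr := left_end_lt_right_end v0_not_interior p.
  have le_r := right_end_le p; rewrite mulSn in le_t.
  split; first by rewrite eb ea; lia.
  - by rewrite eb inZp_left_end.
  - by rewrite ea inZp_right_end.
  apply: le_trans (release_le_last_release _ _) _; apply: late.
  by rewrite eb; lia.
have [K szK HK] := cols v (s %/ n.+1)%N.
pose X := [set p | on_board S v s p].
(* Move [s] runs over edge [s %% n.+1] in subtour [s %/ n.+1], and a ride covering it lies in that
   subtour. *)
have onP p : p \in X -> exists2 r, rides S p = Some r &
    [/\ vipa r = v, board r %/ n.+1 = s %/ n.+1 &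
        left_end p <= s %% n.+1 < right_end p]%N.
  rewrite inE /on_board; case rp: (rides S p) => [r|//] /andP[/eqP vr bs].
  exists r => //; have [t [eb ea _]] := ride _ _ rp.
  have lt_lr := left_end_lt_right_end v0_not_interior p.
  have le_r := right_end_le p.
  have def_s := divn_eq s n.+1; have lt_m := ltn_pmod s (ltn0Sn n).
  have eqt : t = (s %/ n.+1)%N.
    have lt_st : (s - t * n.+1 < n.+1)%N by move: bs; rewrite eb ea; lia.
    have le_ts : (t * n.+1 <= s)%N by move: bs; rewrite eb; lia.
    rewrite -{1}(subnKC le_ts).
    by rewrite divnMDl // (divn_small lt_st) addn0.
  split=> //.
    by rewrite eb divnMDl // divn_small ?left_end_lt // addn0.
  by move: bs; rewrite eb ea eqt; lia.
apply: leq_trans szK; rewrite cardE -(size_map c); apply: uniq_leq_size.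
  rewrite map_inj_in_uniq ?enum_uniq // => p q; rewrite !mem_enum => pX qX cpq.
  apply/eqP; apply: contraTT isT => npq; have := proper _ _ npq.
  rewrite cpq eqxx => -> //; apply/interval_adjP; split=> //.
  have [_ _ [_ _ hp]] := onP _ pX; have [_ _ [_ _ hq]] := onP _ qX.
  by exists (s %% n.+1)%N; rewrite hp.
move=> i /mapP[p]; rewrite mem_enum => /onP[r rp [vr br _]] ->.
exact: HK rp vr br.
Qed.

Lemma remaining_eq0 S : (remaining c S == [::]) = (unserved S == [::]).
Proof.
rewrite /remaining; apply/eqP/eqP => [|-> //].
case: (unserved S) => // p s E.
suff : c p \in undup [seq c q | q <- p :: s] by rewrite E.
by rewrite mem_undup map_f ?mem_head.
Qed.

(** Serving removes the colours in [K] and creates no new ones, so [K] and the colours left are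
    disjoint. *)
Lemma size_remaining_serve S v K : uniq K -> {subset K <= remaining c S} ->
  (size K + size (remaining c (serve len c S v K)) <= size (remaining c S))%N.
Proof.
move=> uK sK; rewrite -size_cat.
have remP i : i \in remaining c (serve len c S v K) ->
    i \notin K /\ i \in remaining c S.
  rewrite mem_undup => /mapP[p]; rewrite unservedP /= => + ->.
  case: ifP => // cpK; split=> //.
  by rewrite mem_undup map_f // unservedP.
apply: uniq_leq_size.
  rewrite cat_uniq uK undup_uniq andbT /=.
  by apply/hasPn => i /remP[].
by move=> i; rewrite mem_cat => /orP[/sK|/remP[]].
Qed.

(** Truncated subtraction also covers a last round with fewer than [Cap] classes. *)
Lemma round_size_remaining S S' : round len Cap c S S' ->
  (size (remaining c S') <= size (remaining c S) - Cap)%N.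
Proof.
case=> _ [v [K [uK sK szK ->]]].
by have := size_remaining_serve v uK sK; rewrite szK; lia.
Qed.

Lemma round_remaining_gt0 S S' :
  round len Cap c S S' -> (0 < size (remaining c S))%N.
Proof. by case=> nz _; rewrite lt0n size_eq0 remaining_eq0. Qed.

Lemma nsubtours_serve S v K : (n.+1 %| size (tour S v))%N ->
  nsubtours (serve len c S v K) = (nsubtours S).+1.
Proof.
move=> dvd; rewrite /nsubtours (bigD1 v) //= eqxx [in RHS](bigD1 v) //=.
rewrite size_cat size_mkseq divnDl // divnn addn1 addSn; congr (_ + _).+1%N.
by apply: eq_bigr => w /negPf ->.
Qed.

(** Each round costs one subtour and one unit of [q]. Leaving [q] free avoids a ceiling and lets it
    be the subtour count of a competing schedule. *)
Lemma loop_nsubtours S S' q : loop len Cap c S S' -> tram_invariant S ->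
  (size (remaining c S) <= q * Cap)%N ->
  (nsubtours S' <= nsubtours S + q)%N.
Proof.
move=> lp; elim: lp q => [{}S _|{}S S1 S2 rnd _ IH] q inv.
  by rewrite leq_addr.
(* With [q] = 0 no colour remains, so no round can start. *)
case: q => [|q]; first by have := round_remaining_gt0 rnd; lia.
have := round_size_remaining rnd.
case: rnd => _ [v [K [uK sK szK eqS1]]].
rewrite eqS1 in IH *; move=> le1 le2.
have [dvd _ _] := inv_tour inv v.
rewrite addnS -addSn -(nsubtours_serve K dvd).
apply: IH; last by move: le2; rewrite mulSn; lia.
by apply: serve_invariant => //; rewrite szK geq_minl.
Qed.

(** The number of remaining colours strictly decreases. *)
Lemma round_acc S : (0 < Cap)%N -> Acc (fun S1 S2 => round len Cap c S2 S1) S.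
Proof.
move=> Cap_gt0; have [b] := ubnP (size (remaining c S)).
elim: b S => [S|b IH S lt_b]; first by rewrite ltn0.
constructor => S' rnd; apply: IH.
by have := round_size_remaining rnd; have := round_remaining_gt0 rnd; lia.
Qed.

Lemma loop_exists S : (0 < k)%N -> (0 < Cap)%N ->
  exists S', loop len Cap c S S'.
Proof.
move=> k_gt0 Cap_gt0; elim: (round_acc S Cap_gt0) => {}S _ IH.
have [u0|u0] := eqVneq (unserved S) [::]; first by exists S; constructor.
(* Any choice would do; VIPA 0 serves the first [Cap] remaining colours. *)
pose K := take Cap (remaining c S).
have rnd : round len Cap c S (serve len c S (Ordinal k_gt0) K).
  split=> //; exists (Ordinal k_gt0), K; split=> //.
  - by rewrite take_uniq ?undup_uniq.
  - by move=> i /mem_take.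
  - by rewrite size_take_min.
have [S' lp] := IH _ rnd; exists S'; exact: loop_round rnd lp.
Qed.

End OptTram.

(** * Comparison of the output with an arbitrary feasible schedule *)

Theorem theorem1 (R : realFieldType) (n : nat) (len : 'I_n.+1 -> R)
    (k Cap m : nat) (sigma : 'I_m -> request R n)
    (len_gt0 : forall i, 0 < len i)
    (k_gt0 : (0 < k)%N) (Cap_gt0 : (0 < Cap)%N)
    (release_ge0 : forall j, 0 <= release (sigma j))
    (v0_not_interior : forall j,
       ~ interior_of_path (origin (sigma j)) (destination (sigma j)) ord0) :
  [/\ opt_tram_terminates len k Cap sigma,
      (exists S : schedule k sigma, opt_tram_output len Cap S) &
      (forall S : schedule k sigma,
         opt_tram_output len Cap S -> optimal len Cap S)].
Proof.
split=> [s _||S [s ls lp]]; first exact: round_acc.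
  pose s := sort (fun p q => left_end p <= left_end q)%N
                 (enum (passenger sigma)).
  pose c := greedy_colouring (@interval_adj R n m sigma) s.
  have [S lp] := loop_exists len c (initial k sigma) k_gt0 Cap_gt0.
  exists S; exists s => //; split; first by rewrite perm_sort.
  by apply: sort_sorted => p q; apply: leq_total.
have us := left_sorted_uniq ls.
set c := greedy_colouring _ s in lp.
have inv0 := initial_invariant len k Cap c.
have inv := loop_invariant len_gt0 lp inv0.
split.
  apply: invariant_feasible inv (loop_unserved lp) => // p q npq.
  apply: greedy_colouring_proper => //; try exact: left_sorted_mem.
  exact: interval_adj_sym.
move=> S' feas; rewrite !total_tour_lengthE; last 2 first.
- by case: feas.
- exact: inv_tour inv.
(* As $|C| \ge 0$, it is enough to compare numbers of subtours. *)
apply: ler_wpMn2l; first by apply: sumr_ge0 => i _; apply: ltW.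
have -> : nsubtours S' = (nsubtours (initial k sigma) + nsubtours S')%N.
  by rewrite [X in (X + _)%N]big1 // => v _; rewrite div0n.
apply: loop_nsubtours lp inv0 _ => //.
(* Every colour is below some load, hence below [nsubtours S' * Cap], which therefore bounds the
   number of colours. *)
rewrite -[leqRHS](size_iota 0); apply: uniq_leq_size; first exact: undup_uniq.
move=> i; rewrite mem_undup => /mapP[p _ ->]; rewrite mem_iota add0n /=.
apply: leq_trans (greedy_colour_lt_load v0_not_interior p ls) _.
exact: load_le feas.
Qed.
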